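(* Let $\mathcal{X}$ be a discrete (finite or countable) state space, and let $\hat{P}$ and $P(\cdot;\boldsymbol{\theta})$ be any strictly positive probability distributions on $\mathcal{X}$, where $\boldsymbol{\theta}$ denotes the parameter of the second distribution. Let $\mathcal{L}(\hat{P},P;\boldsymbol{\theta})$ be the ratio divergence $$\mathcal{L}(\hat{P},P;\boldsymbol{\theta})=\sum_{\boldsymbol{x}',\boldsymbol{x}\in\mathcal{X}}\hat{P}(\boldsymbol{x}')\,P(\boldsymbol{x};\boldsymbol{\theta})\left(\log\frac{\hat{P}(\boldsymbol{x}')\,P(\boldsymbol{x};\boldsymbol{\theta})}{P(\boldsymbol{x}';\boldsymbol{\theta})\,\hat{P}(\boldsymbol{x})}\right)^{2}.$$ Then $$e^{-\left(\mathcal{L}(\hat{P},P;\boldsymbol{\theta})\right)^{1/2}}\le \mathbb{E}_{\hat{P}(\boldsymbol{x}'),\,P(\boldsymbol{x};\boldsymbol{\theta})}\left[\min\left(1,\frac{\hat{P}(\boldsymbol{x}')\,P(\boldsymbol{x};\boldsymbol{\theta})}{P(\boldsymbol{x}';\boldsymbol{\theta})\,\hat{P}(\boldsymbol{x})}\right)\right].$$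
   Context: The expectation $\mathbb{E}_{\hat{P}(\boldsymbol{x}'),P(\boldsymbol{x};\boldsymbol{\theta})}[f(\boldsymbol{x}',\boldsymbol{x})]=\sum_{\boldsymbol{x}',\boldsymbol{x}\in\mathcal{X}}\hat{P}(\boldsymbol{x}')P(\boldsymbol{x};\boldsymbol{\theta})f(\boldsymbol{x}',\boldsymbol{x})$ is over independent $\boldsymbol{x}'\sim\hat{P}$ and $\boldsymbol{x}\sim P(\cdot;\boldsymbol{\theta})$. Here $\log$ is the natural logarithm. If $\mathcal{X}$ is infinite, $\mathcal{L}$ takes values in $[0,\infty]$, with the convention $e^{-\infty}=0$. *)

(* Defs.v *)
From HB Require Import structures.
From mathcomp Require Import all_boot all_order all_algebra.
From mathcomp Require Import all_classical all_reals all_analysis.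

Set Implicit Arguments.
Unset Strict Implicit.
Unset Printing Implicit Defensive.

Import Order.TTheory GRing.Theory Num.Theory.

Local Open Scope classical_set_scope.
Local Open Scope ring_scope.

Definition positive_distribution (R : realType) (X : countType) (p : X -> R)
  : Prop :=
  (forall x, 0 < p x) /\ \esum_(x in [set: X]) (p x)%:E = 1%E.

(* Expectation of f(x', x) over independent x' ~ p and x ~ q, as an element of
   [0, +oo].  The unordered sum [esum] is a supremum of finite partial sums, so
   this is the expectation only for nonnegative f. *)
Definition expectation2 (R : realType) (X : countType) (p q : X -> R)
    (f : X -> X -> R) : \bar R :=
  \esum_(z in [set: X * X]) (p z.1 * q z.2 * f z.1 z.2)%:E.

(* The argument order is (x', x). *)
Definition prob_ratio (R : realType) (X : countType) (p q : X -> R) (x' x : X) : R :=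
  (p x' * q x) / (q x' * p x).

Definition ratio_divergence (R : realType) (X : countType) (Theta : Type)
    (Phat : X -> R) (P : Theta -> X -> R) (theta : Theta) : \bar R :=
  \esum_(z in [set: X * X])
    (Phat z.1 * P theta z.2 *
     (ln (prob_ratio Phat (P theta) z.1 z.2)) ^+ 2)%:E.

(* Main.v *)
Require Import Defs.
From HB Require Import structures.
From mathcomp Require Import all_boot all_order all_algebra.
From mathcomp Require Import all_classical all_reals all_analysis.
From mathcomp Require Import ring lra.

Set Implicit Arguments.
Unset Strict Implicit.
Unset Printing Implicit Defensive.

Import Order.TTheory GRing.Theory Num.Theory.

Local Open Scope classical_set_scope.
Local Open Scope ring_scope.

(** Let t be the logarithm of the ratio and s the square root of the divergence, so that E[t^2] =
    s^2 under the product distribution. Since min(1, e^t) >= e^(-|t|), Jensen's inequality for exp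
    followed by E|t| <= s would give the bound. The proof fuses both inequalities into the pointwise
    estimate [tangent_le_min1_expR], whose only non-constant correction is a multiple of t^2.
    Averaging it in [expRN_le_esum_min1] uses E[t^2] = s^2 alone and involves only sums of
    nonnegative terms, as [esum] requires. *)

Lemma esumZl (R : realType) (T : choiceType) (I : set T) (a : T -> \bar R)
    (r : R) : 0 <= r -> (forall i, I i -> (0 <= a i)%E) ->
  (\esum_(i in I) (r%:E * a i) = r%:E * \esum_(i in I) a i)%E.
Proof.
move=> r0 a0; rewrite /esum -ereal_supZl//; last first.
  by apply/set0P; eexists; exists set0; [exact: fsets_set0|reflexivity].
rewrite image_comp; congr ereal_sup; apply: eq_imagel => A [finA AI] /=.
rewrite !fsbig_finite// big_seq [in RHS]big_seq ge0_sume_distrr// => i.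
by rewrite in_fset_set// inE => /AI/a0.
Qed.

(** By Tonelli the double sum can be iterated, and each inner sum over the second variable collapses
    to [p x]. *)
Lemma positive_distributionM (R : realType) (X : countType) (p q : X -> R) :
  positive_distribution p -> positive_distribution q ->
  \esum_(z in [set: X * X]) (p z.1 * q z.2)%:E = 1%E.
Proof.
move=> [p0 p1] [q0 q1].
have -> : [set: X * X] = setT `*`` (fun=> setT) by apply/seteqP; split.
rewrite -(esum_esum (a := fun x y => (p x * q y)%:E)); last first.
  by move=> x y _ _; rewrite lee_fin mulr_ge0// ltW.
rewrite -p1; apply: eq_esum => x _.
under eq_esum do rewrite EFinM.
by rewrite esumZl ?q1 ?mule1 ?ltW// => y _; rewrite lee_fin ltW.
Qed.

(* The tangent line of [expR] at [- s] gives
   [expR (- s) * (1 + s - `|t|)] as a lower bound of [Num.min 1 (expR t)], and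
   [`|t| <= t ^+ 2 / (2 * s) + s / 2] by AM-GM. *)
Lemma tangent_le_min1_expR (R : realType) (s t : R) : 0 < s ->
  expR (- s) * (1 + s / 2) <=
  Num.min 1 (expR t) + expR (- s) / (2 * s) * t ^+ 2.
Proof.
move=> s0; have es0 := expR_ge0 (- s).
have amgm : `|t| <= t ^+ 2 / (2 * s) + s / 2.
  rewrite -real_normK ?num_real// -subr_ge0.
  have -> : `|t| ^+ 2 / (2 * s) + s / 2 - `|t| = (`|t| - s) ^+ 2 / (2 * s).
    by field; rewrite gt_eqF.
  by rewrite divr_ge0 ?sqr_ge0// mulr_ge0// ltW.
have tangent u : - `|t| <= u -> expR (- s) * (1 + s - `|t|) <= expR u.
  move=> tu; have -> : u = - s + (s + u) by ring.
  rewrite expRD ler_wpM2l//; apply: le_trans (expR_ge1Dx _); lra.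
have min_ge : expR (- s) * (1 + s - `|t|) <= Num.min 1 (expR t).
  rewrite le_min -[X in _ <= X]expR0 !tangent ?oppr_le0//.
  by rewrite lerNl -normrN ler_norm.
have := ler_wpM2l es0 amgm.
have -> : expR (- s) / (2 * s) * t ^+ 2 = expR (- s) * (t ^+ 2 / (2 * s)).
  by field; rewrite gt_eqF.
lra.
Qed.

(** Averaging the pointwise estimate against [w] turns its quadratic term into e^(-s) / (2s) * s^2 =
    e^(-s) * s / 2, exactly the excess of the left side over e^(-s). *)
Lemma expRN_le_esum_min1 (R : realType) (T : choiceType) (w t : T -> R)
    (s : R) :
  (forall z, 0 < w z) -> (\esum_(z in [set: T]) (w z)%:E = 1)%E -> 0 <= s ->
  (\esum_(z in [set: T]) (w z * t z ^+ 2)%:E = (s ^+ 2)%:E)%E ->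
  ((expR (- s))%:E <= \esum_(z in [set: T]) (w z * Num.min 1 (expR (t z)))%:E)%E.
Proof.
move=> w0 w1; rewrite le_eqVlt => /predU1P[<-|s0] L.
  (* The estimate divides by [s], so [s = 0] is separate: each term is bounded by the vanishing
     total, and [w z > 0] then forces [t z = 0]. *)
  rewrite oppr0 expR0 -w1; apply: le_esum => z _.
  suff -> : t z = 0 by rewrite expR0 minxx mulr1.
  have : ((w z * t z ^+ 2)%:E <= 0%:E)%E.
    move: L; rewrite expr0n /= => <-; apply: esum_ge; exists [set z]; first by split.
    by rewrite fsbig_set1.
  rewrite lee_fin pmulr_rle0// => tz; apply/eqP.
  by rewrite -sqrf_eq0 eq_le tz sqr_ge0.
have es0 := expR_ge0 (- s).
have k0 : 0 <= expR (- s) / (2 * s) by rewrite divr_ge0// mulr_ge0// ltW.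
(* The quadratic term stays on the larger side, so that nothing negative is summed; it is subtracted
   only after its sum is known to be finite. *)
have sum_le : (\esum_(z in [set: T]) ((expR (- s) * (1 + s / 2))%:E * (w z)%:E) <=
    \esum_(z in [set: T]) ((w z * Num.min 1 (expR (t z)))%:E +
      (expR (- s) / (2 * s))%:E * (w z * t z ^+ 2)%:E))%E.
  apply: le_esum => z _; rewrite -!EFinM -EFinD lee_fin.
  by rewrite mulrC [X in _ <= _ + X]mulrCA -mulrDr ler_pM2l//
    tangent_le_min1_expR.
move: sum_le; rewrite esumD; last 2 first.
- by move=> z _; rewrite lee_fin mulr_ge0 ?le_min ?ler01 ?expR_ge0// ltW.
- by move=> z _; rewrite -EFinM lee_fin mulr_ge0// mulr_ge0 ?sqr_ge0// ltW.
rewrite !esumZl//; last 3 first.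
- by move=> z _; rewrite lee_fin mulr_ge0 ?sqr_ge0// ltW.
- by rewrite mulr_ge0// addr_ge0// divr_ge0// ltW.
- by move=> z _; rewrite lee_fin ltW.
rewrite w1 mule1 L -EFinM -leeBlDr// -EFinB.
congr (_%:E <= _)%E; field; by rewrite gt_eqF.
Qed.

Theorem mainTheorem1 (R : realType) (X : countType) (Theta : Type)
    (Phat : X -> R) (P : Theta -> X -> R) (theta : Theta)
    (hPhat : positive_distribution Phat)
    (hP : positive_distribution (P theta)) :
  (expeR (- (ratio_divergence Phat P theta `^ (2^-1)%R))
   <= expectation2 Phat (P theta)
        (fun x' x => Num.min 1 (prob_ratio Phat (P theta) x' x))%R)%E.
Proof.
have [p0 _] := hPhat; have [q0 _] := hP.
have r0 x' x : 0 < prob_ratio Phat (P theta) x' x.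
  by rewrite /prob_ratio divr_gt0// mulr_gt0.
have f0 f : (forall z : X * X, 0 <= f z) ->
    (0 <= \esum_(z in [set: X * X]) (Phat z.1 * P theta z.2 * f z)%:E)%E.
  by move=> fge0; apply: esum_ge0 => z _; rewrite lee_fin !mulr_ge0// ltW.
have : (0 <= ratio_divergence Phat P theta)%E by apply: f0 => z; rewrite sqr_ge0.
case L : ratio_divergence => [l| |]// l0; last first.
  (* For an infinite divergence the left side is e^(-oo) = 0, and nonnegativity of the expectation
     suffices. *)
  rewrite poweRyr ?invr_neq0// /=.
  by apply: f0 => z; rewrite le_min ler01 ltW.
rewrite lee_fin in l0.
rewrite poweR12_sqrt//= /expectation2.
(* Writing the ratio as the exponential of its logarithm exposes the [t] whose second moment is the
   divergence. *)
under eq_esum => z _ do rewrite -[prob_ratio _ _ _ _]lnK ?posrE//.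
apply: (@expRN_le_esum_min1 _ _ (fun z => Phat z.1 * P theta z.2)).
- by move=> z; rewrite mulr_gt0.
- exact: positive_distributionM.
- exact: sqrtr_ge0.
- by rewrite sqr_sqrtr// -L.
Qed.
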